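(* Consider the category $\mathsf{Mon}$ of monoids, equipped with the free monoid comonad $(P,\delta,\varepsilon)$ as functorial projective covers. Let $f\colon X\to Y$ be a split epimorphism of monoids with chosen section $s\colon Y\to X$ ($fs=1_Y$) and kernel $k\colon K\to X$. (1) $(f,s)$ is an intrinsic Schreier split epimorphism with respect to the direct imaginary splitting $t^d$ if and only if it is a Schreier (= right homogeneous) split epimorphism. (2) $(f,s)$ is an intrinsic Schreier split epimorphism with respect to the twisted imaginary splitting $t^w$ if and only if it is a left homogeneous split epimorphism. (3) Hence, $(f,s)$ is a homogeneous split epimorphism if and only if it is an intrinsic Schreier split epimorphism with respect to every natural imaginary splitting $t$.
   Context: Monoids are written multiplicatively. $P(X)$ is the free monoid on the underlying set of $X$, with generators (one-letter words) $[x]$, $x\in X$; $\varepsilon_X\colon P(X)\to X$ is the monoid morphism with $\varepsilon_X([x])=x$, and $\delta_X\colon P(X)\to P^2(X)=P(P(X))$ is the monoid morphism with $\delta_X([x])=[[x]]$. Notation: $A+B$ is the coproduct (free product) with injections $\iota_A,\iota_B$; for $u\colon A\to C$, $v\colon B\to C$, $(u\mid v)\colon A+B\to C$ is the induced morphism (copairing); $\langle -,-\rangle$ denotes pairing into a product. $r_{A,B}\colon A+B\to A\times B$ is the comparison morphism with $r_{A,B}\iota_A=\langle 1_A,0\rangle$ and $r_{A,B}\iota_B=\langle 0,1_B\rangle$. A natural imaginary splitting is a natural transformation $t\colon P((\cdot)\times(\cdot))\Rightarrow(\cdot)+(\cdot)$ of functors of two variables, with components $t_{A,B}\colon P(A\times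 B)\to A+B$, such that $r_{A,B}t_{A,B}=\varepsilon_{A\times B}$ for all $A,B$. The direct one $t^d$ is determined by $t^d_{A,B}([(a,b)])=\iota_A(a)\cdot\iota_B(b)$, and the twisted one $t^w$ by $t^w_{A,B}([(a,b)])=\iota_B(b)\cdot\iota_A(a)$. The split epimorphism $(f,s)$ with kernel $k\colon K\to X$ is an intrinsic Schreier split epimorphism with respect to $t$ if there is a morphism $q\colon P(X)\to K$ such that (iS1) $(kq\mid sf\varepsilon_X)\, t_{P(X),P(X)}\, P(\langle 1_{P(X)},1_{P(X)}\rangle)\,\delta_X=\varepsilon_X$; (iS2) $q\,P((k\mid s))\,P(t_{K,Y})\,\delta_{K\times Y}=\pi_K\,\varepsilon_{K\times Y}$. $(f,s)$ is a Schreier (or right homogeneous) split epimorphism if for every $x\in X$ there is a unique $a\in K$ with $x=k(a)\cdot sf(x)$; it is left homogeneous if for every $x\in X$ there is a unique $a\in K$ with $x=sf(x)\cdot k(a)$; it is homogeneous if it is both left and right homogeneous. *)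

(* Defs.v *)
From HB Require Import structures.
From mathcomp Require Import all_boot.
From mathcomp Require Import boolp.

Set Implicit Arguments.
Unset Strict Implicit.
Unset Printing Implicit Defensive.

Local Open Scope quotient_scope.
Local Open Scope group_scope.

(* {multiplicative G -> H} does not require 1 to be preserved, so the arrows
   of the category of monoids are the unital ones. Arrows are compared with
   pointwise equality (=1). *)
Notation "{ 'mon' G -> H }" := (UMagmaMorphism.type G%type H%type)
  (at level 0, G at level 98, H at level 99,
   format "{ 'mon'  G  ->  H }") : type_scope.

Section Pairing.
Variables A B C : monoidType.

Definition pairing (u : C -> A) (v : C -> B) (c : C) : A * B := (u c, v c).

Fact pairing_monoid_morphism (u : {mon C -> A}) (v : {mon C -> B}) :
  monoid_morphism (pairing u v).
Proof.
by split=> [|x y]; rewrite /pairing ?gmulf1 // !gmulfM.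
Qed.

HB.instance Definition _ (u : {mon C -> A}) (v : {mon C -> B}) :=
  isUMagmaMorphism.Build C (A * B)%type (pairing u v)
    (pairing_monoid_morphism u v).
End Pairing.

Definition prod_map (A B C D : monoidType) (u : {mon A -> C})
  (v : {mon B -> D}) : {mon A * B -> C * D} := pairing (u \o fst) (v \o snd).

Definition freemon (X : choiceType) : Type := seq X.

Section FreeMonoid.
Variable X : choiceType.

HB.instance Definition _ := Choice.on (freemon X).
HB.instance Definition _ :=
  isMonoid.Build (freemon X) (@catA X) (@cat0s X) (@cats0 X).

Definition letter (x : X) : freemon X := [:: x].

Definition freemon_ext (M : monoidType) (g : X -> M) (w : freemon X) : M :=
  \prod_(x <- w) g x.

Fact freemon_ext_monoid_morphism (M : monoidType) (g : X -> M) :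
  monoid_morphism (freemon_ext g).
Proof.
split=> [|u v]; first by rewrite /freemon_ext big_nil.
by rewrite /freemon_ext big_cat.
Qed.

HB.instance Definition _ (M : monoidType) (g : X -> M) :=
  isUMagmaMorphism.Build (freemon X) M (freemon_ext g)
    (freemon_ext_monoid_morphism g).

Lemma freemon_ext_letter (M : monoidType) (g : X -> M) (x : X) :
  freemon_ext g (letter x) = g x.
Proof. by rewrite /freemon_ext big_seq1. Qed.

Lemma freemon_ext_uniq (M : monoidType) (g : X -> M)
    (h : {mon freemon X -> M}) :
  (forall x, h (letter x) = g x) -> h =1 freemon_ext g.
Proof.
move=> hg; elim=> [|x w IH]; first by rewrite /freemon_ext big_nil gmulf1.
rewrite /freemon_ext big_cons -/(freemon_ext g w) -IH -hg.
by rewrite -gmulfM.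
Qed.
End FreeMonoid.

Lemma freemon_eq (X : choiceType) (M : monoidType)
    (g h : {mon freemon X -> M}) :
  (forall x, g (letter x) = h (letter x)) -> g =1 h.
Proof.
by move=> gh w; rewrite (freemon_ext_uniq gh) -(freemon_ext_uniq (fun=> erefl)).
Qed.

Definition freemon_map (X Y : choiceType) (g : X -> Y) :
  {mon freemon X -> freemon Y} := freemon_ext (fun x => letter (g x)).

Definition eps (X : monoidType) : {mon freemon X -> X} :=
  freemon_ext (fun x => x).

Definition delta (X : monoidType) : {mon freemon X -> freemon (freemon X)} :=
  freemon_ext (fun x => letter (letter x)).

(* The free product A + B is the quotient of the free monoid on the disjoint
   union of A and B by the congruence making both inclusions morphisms. *)
Inductive coprod_cong (A B : monoidType) :
  freemon (A + B)%type -> freemon (A + B)%type -> Prop :=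
| CongRefl w : coprod_cong w w
| CongSym w1 w2 : coprod_cong w1 w2 -> coprod_cong w2 w1
| CongTrans w1 w2 w3 :
    coprod_cong w1 w2 -> coprod_cong w2 w3 -> coprod_cong w1 w3
| CongMul w1 w1' w2 w2' : coprod_cong w1 w1' -> coprod_cong w2 w2' ->
    coprod_cong (w1 * w2) (w1' * w2')
| CongInl1 : coprod_cong (letter (inl 1)) 1
| CongInlM a a' :
    coprod_cong (letter (inl (a * a'))) (letter (inl a) * letter (inl a'))
| CongInr1 : coprod_cong (letter (inr 1)) 1
| CongInrM b b' :
    coprod_cong (letter (inr (b * b'))) (letter (inr b) * letter (inr b')).

Section Coproduct.
Variables A B : monoidType.
Local Notation word := (freemon (A + B)%type).

Definition coprod_rel : rel word := fun w1 w2 => `[< coprod_cong w1 w2 >].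

Fact coprod_rel_equiv : equiv_class_of coprod_rel.
Proof.
split=> [w|w1 w2|w2 w1 w3].
- by apply/asboolP; exact: CongRefl.
- by apply/asboolP/asboolP; exact: CongSym.
- by move=> /asboolP h12 /asboolP h23; apply/asboolP; exact: CongTrans h12 h23.
Qed.

Canonical coprod_equiv := EquivRelPack coprod_rel_equiv.

Definition coprod : Type := {eq_quot coprod_rel}.
HB.instance Definition _ := Choice.on coprod.

Definition coprod_class (w : word) : coprod := \pi_{eq_quot coprod_rel} w.

Lemma coprod_classP (w1 w2 : word) :
  coprod_class w1 = coprod_class w2 <-> coprod_cong w1 w2.
Proof.
by split=> [/eqP|h]; [rewrite eqmodE => /asboolP|apply/eqP; rewrite eqmodE; apply/asboolP].
Qed.

Definition coprod_repr (z : coprod) : word :=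
  repr (z : {eq_quot coprod_rel}).

Lemma coprod_reprK : cancel coprod_repr coprod_class.
Proof. by move=> z; exact: reprK. Qed.

Lemma coprod_repr_cong (w : word) :
  coprod_cong (coprod_repr (coprod_class w)) w.
Proof. by apply/coprod_classP; rewrite coprod_reprK. Qed.

Definition coprod_one : coprod := coprod_class 1.
Definition coprod_mul (z1 z2 : coprod) : coprod :=
  coprod_class (coprod_repr z1 * coprod_repr z2).

Lemma coprod_mulE (w1 w2 : word) :
  coprod_mul (coprod_class w1) (coprod_class w2) = coprod_class (w1 * w2).
Proof. by apply/coprod_classP/CongMul; exact: coprod_repr_cong. Qed.

Fact coprod_mulA : associative coprod_mul.
Proof.
move=> x y z; rewrite -(coprod_reprK x) -(coprod_reprK y) -(coprod_reprK z).
by rewrite !coprod_mulE mulgA.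
Qed.

Fact coprod_mul1 : left_id coprod_one coprod_mul.
Proof. by move=> x; rewrite -(coprod_reprK x) coprod_mulE mul1g. Qed.

Fact coprod_mul1r : right_id coprod_one coprod_mul.
Proof. by move=> x; rewrite -(coprod_reprK x) coprod_mulE mulg1. Qed.

HB.instance Definition _ :=
  isMonoid.Build coprod coprod_mulA coprod_mul1 coprod_mul1r.

Lemma coprod_classM (w1 w2 : word) :
  coprod_class (w1 * w2) = coprod_class w1 * coprod_class w2.
Proof. exact: esym (coprod_mulE w1 w2). Qed.

Definition iotal (a : A) : coprod := coprod_class (letter (inl a)).
Definition iotar (b : B) : coprod := coprod_class (letter (inr b)).

Fact iotal_monoid_morphism : monoid_morphism iotal.
Proof.
split=> [|a a']; first by apply: (proj2 (coprod_classP _ 1)); exact: CongInl1.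
by rewrite -coprod_classM; apply: (proj2 (coprod_classP _ _)); exact: CongInlM.
Qed.

Fact iotar_monoid_morphism : monoid_morphism iotar.
Proof.
split=> [|b b']; first by apply: (proj2 (coprod_classP _ 1)); exact: CongInr1.
by rewrite -coprod_classM; apply: (proj2 (coprod_classP _ _)); exact: CongInrM.
Qed.

HB.instance Definition _ :=
  isUMagmaMorphism.Build A coprod iotal iotal_monoid_morphism.
HB.instance Definition _ :=
  isUMagmaMorphism.Build B coprod iotar iotar_monoid_morphism.
End Coproduct.

Arguments iotal A B a : clear implicits.
Arguments iotar A B b : clear implicits.

Section Copairing.
Variables A B C : monoidType.
Implicit Types (u : {mon A -> C}) (v : {mon B -> C}).

Definition copair_letter u v (z : A + B) : C :=
  match z with inl a => u a | inr b => v b end.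

Definition copair_fun u v (z : coprod A B) : C :=
  freemon_ext (copair_letter u v) (coprod_repr z).

Lemma copair_cong u v (w1 w2 : freemon (A + B)%type) : coprod_cong w1 w2 ->
  freemon_ext (copair_letter u v) w1 = freemon_ext (copair_letter u v) w2.
Proof.
elim=> {w1 w2} // [w1 w2 w3 _ -> _ -> //|w1 w1' w2 w2' _ h1 _ h2||||].
- by rewrite !gmulfM /= h1 h2.
- by rewrite freemon_ext_letter gmulf1 /= gmulf1.
- by move=> a a'; rewrite [RHS]gmulfM /= !freemon_ext_letter /= gmulfM.
- by rewrite freemon_ext_letter gmulf1 /= gmulf1.
- by move=> b b'; rewrite [RHS]gmulfM /= !freemon_ext_letter /= gmulfM.
Qed.

Lemma copair_funE u v (w : freemon (A + B)%type) :
  copair_fun u v (coprod_class w) = freemon_ext (copair_letter u v) w.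
Proof. by apply: copair_cong; exact: coprod_repr_cong. Qed.

Fact copair_monoid_morphism u v : monoid_morphism (copair_fun u v).
Proof.
split=> [|x y]; first by rewrite copair_funE gmulf1.
rewrite -(coprod_reprK x) -(coprod_reprK y) -coprod_classM !copair_funE.
exact: gmulfM.
Qed.

HB.instance Definition _ u v :=
  isUMagmaMorphism.Build (coprod A B) C (copair_fun u v)
    (copair_monoid_morphism u v).

Definition copair u v : {mon coprod A B -> C} := copair_fun u v.

Lemma copair_iotal u v (a : A) : copair u v (iotal A B a) = u a.
Proof. by rewrite /= copair_funE freemon_ext_letter. Qed.

Lemma copair_iotar u v (b : B) : copair u v (iotar A B b) = v b.
Proof. by rewrite /= copair_funE freemon_ext_letter. Qed.

Lemma copair_uniq u v (h : {mon coprod A B -> C}) :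
  h \o iotal A B =1 u -> h \o iotar A B =1 v -> h =1 copair u v.
Proof.
move=> hu hv z; rewrite -(coprod_reprK z) /= copair_funE.
elim: (coprod_repr z) => [|x w IH].
  by rewrite /freemon_ext big_nil gmulf1.
rewrite -[x :: w]/(letter x * w) [RHS]gmulfM /= -IH coprod_classM.
rewrite [LHS]gmulfM freemon_ext_letter; congr (_ * _).
by case: x => [a|b] /=; rewrite -?hu -?hv.
Qed.
End Copairing.

Definition coprod_map (A B C D : monoidType) (u : {mon A -> C})
    (v : {mon B -> D}) : {mon coprod A B -> coprod C D} :=
  copair (iotal C D \o u) (iotar C D \o v).

(* The morphism r_{A,B} with components <1_A, 0> and <0, 1_B>. *)
Definition comparison (A B : monoidType) : {mon coprod A B -> A * B} :=
  copair (pairing (idfun : {mon A -> A}) (one_fun _ : {mon A -> B}))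
         (pairing (one_fun _ : {mon B -> A}) (idfun : {mon B -> B})).

Record nat_imag_splitting := NatImagSplitting {
  imag_split :> forall A B : monoidType, {mon freemon (A * B)%type -> coprod A B};
  imag_split_natural : forall (A B C D : monoidType)
      (u : {mon A -> C}) (v : {mon B -> D}),
    imag_split C D \o freemon_map (prod_map u v)
      =1 coprod_map u v \o imag_split A B;
  imag_split_comparison : forall A B : monoidType,
    comparison A B \o imag_split A B =1 eps (A * B)%type
}.

Definition direct_fun (A B : monoidType) :
    {mon freemon (A * B)%type -> coprod A B} :=
  freemon_ext (fun p : A * B => iotal A B p.1 * iotar A B p.2).

Definition twisted_fun (A B : monoidType) :
    {mon freemon (A * B)%type -> coprod A B} :=
  freemon_ext (fun p : A * B => iotar A B p.2 * iotal A B p.1).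

Fact direct_natural (A B C D : monoidType)
    (u : {mon A -> C}) (v : {mon B -> D}) :
  direct_fun C D \o freemon_map (prod_map u v)
    =1 coprod_map u v \o direct_fun A B.
Proof.
apply: freemon_eq => -[a b].
rewrite /= !freemon_ext_letter /= gmulfM.
by rewrite copair_iotal copair_iotar.
Qed.

Fact direct_comparison (A B : monoidType) :
  comparison A B \o direct_fun A B =1 eps (A * B)%type.
Proof.
apply: freemon_eq => -[a b].
rewrite /= !freemon_ext_letter /= gmulfM copair_iotal copair_iotar.
by congr pair; rewrite /= ?mulg1 ?mul1g.
Qed.

Fact twisted_natural (A B C D : monoidType)
    (u : {mon A -> C}) (v : {mon B -> D}) :
  twisted_fun C D \o freemon_map (prod_map u v)
    =1 coprod_map u v \o twisted_fun A B.
Proof.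
apply: freemon_eq => -[a b].
rewrite /= !freemon_ext_letter /= gmulfM.
by rewrite copair_iotal copair_iotar.
Qed.

Fact twisted_comparison (A B : monoidType) :
  comparison A B \o twisted_fun A B =1 eps (A * B)%type.
Proof.
apply: freemon_eq => -[a b].
rewrite /= !freemon_ext_letter /= gmulfM copair_iotal copair_iotar.
by congr pair; rewrite /= ?mulg1 ?mul1g.
Qed.

Definition t_direct : nat_imag_splitting :=
  NatImagSplitting direct_natural direct_comparison.

Definition t_twisted : nat_imag_splitting :=
  NatImagSplitting twisted_natural twisted_comparison.

Definition is_kernel (K X Y : monoidType) (k : {mon K -> X})
    (f : {mon X -> Y}) : Prop :=
  (f \o k =1 one_fun Y) /\
  forall (Z : monoidType) (g : {mon Z -> X}), f \o g =1 one_fun Y ->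
    exists h : {mon Z -> K},
      k \o h =1 g /\ forall h' : {mon Z -> K}, k \o h' =1 g -> h' =1 h.

Section SplitEpi.
Variables (X Y K : monoidType).
Variables (f : {mon X -> Y}) (s : {mon Y -> X}) (k : {mon K -> X}).

Definition intrinsic_schreier (t : nat_imag_splitting) : Prop :=
  exists q : {mon freemon X -> K},
    (copair (k \o q) (s \o f \o eps X) \o t (freemon X) (freemon X)
       \o freemon_map (pairing idfun idfun) \o delta X =1 eps X) /\
    (q \o freemon_map (copair k s) \o freemon_map (t K Y)
       \o delta (K * Y)%type =1 fst \o eps (K * Y)%type).

(* Also called a Schreier split epimorphism. *)
Definition right_homogeneous : Prop :=
  forall x : X, exists! a : K, x = k a * s (f x).

Definition left_homogeneous : Prop :=
  forall x : X, exists! a : K, x = s (f x) * k a.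

Definition homogeneous : Prop := left_homogeneous /\ right_homogeneous.
End SplitEpi.

(* Main.v *)
Require Import Defs.
From HB Require Import structures.
From mathcomp Require Import all_boot.
From mathcomp Require Import boolp.

Set Implicit Arguments.
Unset Strict Implicit.
Unset Printing Implicit Defensive.

Local Open Scope group_scope.

(** Monoids have only two natural imaginary splittings. The reason is a
    universality argument. Write N for the free monoid on one letter n. A pair
    (a, b) in A x B is the image of (n, n) under the product of the morphisms
    N -> A and N -> B that send n to a and to b, so naturality determines all
    components of t from the single element t_{N,N}([(n, n)]) of N + N. Now
    N + N is the free monoid on two letters, and being sent to (n, n) by the
    comparison morphism says that each of the two letters occurs exactly once:
    the element is iota_l(n) iota_r(n) or iota_r(n) iota_l(n). In the first case
    t is direct, in the second it is twisted ([imag_split_cases]).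

    For either splitting the two conditions on q are equalities between
    morphisms out of free monoids, so it suffices to test them on letters. With
    products in the order given by the splitting, they read
    k(q[x]) . s(f(x)) = x and q[k(a) . s(y)] = a. The first one is existence in
    the homogeneity condition, and the second one forces uniqueness; conversely,
    the unique decompositions define q on letters, hence on the free monoid
    ([intrinsic_schreier_orderedP]). *)

(** The two orders are treated at once: the Boolean chooses between the direct
    and the twisted form, so that no argument has to be mirrored. *)
Definition omul (M : monoidType) (d : bool) (x y : M) : M :=
  if d then x * y else y * x.

Lemma gmulf_omul (M N : monoidType) (g : {mon M -> N}) d x y :
  g (omul d x y) = omul d (g x) (g y).
Proof. by case: d; rewrite /omul gmulfM. Qed.

Lemma freemon_map_letter (X Y : choiceType) (g : X -> Y) x :
  freemon_map g (letter x) = letter (g x).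
Proof. exact: freemon_ext_letter. Qed.

Lemma eps_letter (X : monoidType) (x : X) : eps X (letter x) = x.
Proof. exact: freemon_ext_letter. Qed.

Lemma delta_letter (X : monoidType) (x : X) :
  delta X (letter x) = letter (letter x).
Proof. exact: freemon_ext_letter. Qed.

Definition ordered_splitting (d : bool) (t : nat_imag_splitting) : Prop :=
  forall (A B : monoidType) (a : A) (b : B),
    t A B (letter (a, b)) = omul d (iotal A B a) (iotar A B b).

Lemma t_direct_ordered : ordered_splitting true t_direct.
Proof. by move=> A B a b; rewrite /= freemon_ext_letter. Qed.

Lemma t_twisted_ordered : ordered_splitting false t_twisted.
Proof. by move=> A B a b; rewrite /= freemon_ext_letter. Qed.

Local Notation N := (freemon unit).
Local Notation n := (letter tt).

(** N + N is free on two letters. The next map recovers the word in these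
    letters, true for the left one and false for the right one, and
    [word_coprod] reads such a word back in N + N. *)
Definition bool_word : {mon coprod N N -> freemon bool} :=
  copair (freemon_map (fun=> true)) (freemon_map (fun=> false)).

Definition word_coprod : {mon freemon bool -> coprod N N} :=
  freemon_ext (fun b : bool => if b then iotal N N n else iotar N N n).

Lemma bool_wordK : cancel bool_word word_coprod.
Proof.
have El : bool_word (iotal N N n) = letter true.
  by rewrite copair_iotal /= freemon_ext_letter.
have Er : bool_word (iotar N N n) = letter false.
  by rewrite copair_iotar /= freemon_ext_letter.
have E : word_coprod \o bool_word =1 copair (iotal N N) (iotar N N).
  apply: copair_uniq; apply: freemon_eq => -[].
    rewrite -[LHS]/(word_coprod (bool_word (iotal N N n))) El.
    by rewrite /= freemon_ext_letter.
  rewrite -[LHS]/(word_coprod (bool_word (iotar N N n))) Er.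
  by rewrite /= freemon_ext_letter.
have E' : idfun =1 copair (iotal N N) (iotar N N) by apply: copair_uniq.
by move=> z; rewrite -[LHS]/((word_coprod \o bool_word) z) E -E'.
Qed.

Lemma size_comparison (w : freemon bool) :
  size (comparison N N (word_coprod w)).1 = count id w /\
  size (comparison N N (word_coprod w)).2 = count negb w.
Proof.
elim: w => [|b w [IH1 IH2]]; first by rewrite gmulf1 gmulf1.
rewrite -[b :: w]/(letter b * w) !gmulfM !size_cat IH1 IH2.
rewrite /word_coprod /= freemon_ext_letter.
by case: b; rewrite /= ?copair_iotal ?copair_iotar.
Qed.

(** The comparison morphism counts the letters of each kind, so over (n, n)
    there are just the two words with one letter of each kind. *)
Lemma comparison_fiber (z : coprod N N) : comparison N N z = (n, n) ->
  exists d, z = omul d (iotal N N n) (iotar N N n).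
Proof.
move=> hz; have := size_comparison (bool_word z).
rewrite bool_wordK hz -[z in exists d, z = _]bool_wordK.
case: (bool_word z) => [|b1 [|b2 [|b3 w]]] [/= h1 h2].
- by [].
- by case: b1 h1 h2.
- exists b1; rewrite -[[:: b1; b2]]/(letter b1 * letter b2) gmulfM.
  rewrite /word_coprod /= !freemon_ext_letter.
  by case: b1 b2 h1 h2 => -[].
- by case: b1 b2 b3 h1 h2 => -[] [].
Qed.

(** Naturality along the morphisms N -> A and N -> B naming a and b carries the
    order found in N + N to all components at once. *)
Lemma imag_split_cases (t : nat_imag_splitting) :
  exists d, ordered_splitting d t.
Proof.
have [|d hd] := @comparison_fiber (t N N (letter (n, n))).
  rewrite -[LHS]/((comparison N N \o t N N) _) imag_split_comparison.
  exact: eps_letter.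
exists d => A B a b.
pose u : {mon N -> A} := freemon_ext (fun=> a).
pose v : {mon N -> B} := freemon_ext (fun=> b).
have -> : letter (a, b) = freemon_map (prod_map u v) (letter (n, n)).
  by rewrite freemon_map_letter /= /pairing /= !freemon_ext_letter.
rewrite -[LHS]/((t A B \o freemon_map _) _) imag_split_natural /comp hd.
by rewrite gmulf_omul copair_iotal copair_iotar /= !freemon_ext_letter.
Qed.

Section SplitEpi.
Variables (X Y K : monoidType).
Variables (f : {mon X -> Y}) (s : {mon Y -> X}) (k : {mon K -> X}).
Hypotheses (fs : f \o s =1 idfun) (fk : f \o k =1 one_fun Y).

(** On letters, with q0 the restriction of q to letters, the two conditions
    only involve elements of X, K and Y. *)
Lemma intrinsic_schreier_letters d t : ordered_splitting d t ->
  intrinsic_schreier f s k t <->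
  exists q0 : X -> K, (forall x, omul d (k (q0 x)) (s (f x)) = x) /\
    (forall a y, q0 (omul d (k a) (s y)) = a).
Proof.
move=> ht.
have E1 (q : {mon freemon X -> K}) (x : X) :
    (copair (k \o q) (s \o f \o eps X) \o t (freemon X) (freemon X)
      \o freemon_map (pairing idfun idfun) \o delta X) (letter x)
    = omul d (k (q (letter x))) (s (f x)).
  rewrite /comp delta_letter freemon_map_letter ht gmulf_omul.
  by rewrite copair_iotal copair_iotar /= -/(eps X) eps_letter.
have E2 (q : {mon freemon X -> K}) (a : K) (y : Y) :
    (q \o freemon_map (copair k s) \o freemon_map (t K Y)
      \o delta (K * Y)%type) (letter (a, y))
    = q (letter (omul d (k a) (s y))).
  rewrite /comp delta_letter !freemon_map_letter ht gmulf_omul.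
  by rewrite copair_iotal copair_iotar.
split=> [[q [iS1 iS2]]|[q0 [h1 h2]]].
  exists (fun x => q (letter x)); split=> [x|a y].
    by rewrite -E1 iS1 eps_letter.
  by rewrite -E2 iS2 /comp eps_letter.
exists (freemon_ext q0); split; apply: freemon_eq.
  move=> x; apply: etrans (E1 _ x) _.
  by rewrite eps_letter /= freemon_ext_letter h1.
move=> [a y]; apply: etrans (E2 _ a y) _.
by rewrite /= freemon_ext_letter h2 -/(eps _) eps_letter.
Qed.

(** Since f (k a . s y) = y in either order, the factor s y of a product
    k a . s y is the one that the homogeneity condition prescribes. *)
Lemma intrinsic_schreier_orderedP d t : ordered_splitting d t ->
  intrinsic_schreier f s k t <->
  forall x, exists! a, x = omul d (k a) (s (f x)).
Proof.
move=> ht; rewrite (intrinsic_schreier_letters ht); split=> [[q0 [h1 h2]] x|h].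
  exists (q0 x); split=> [|a xE]; first by rewrite h1.
  by rewrite xE h2.
have fE a y : f (omul d (k a) (s y)) = y.
  rewrite gmulf_omul -[f (k a)]/((f \o k) a) fk -[f (s y)]/((f \o s) y) fs.
  by case: d {ht h}; rewrite /omul /= ?mul1g ?mulg1.
have [q0 hq0] := choice h.
exists q0; split=> [x|a y]; first by case: (hq0 x).
by have [_] := hq0 (omul d (k a) (s y)); apply; rewrite fE.
Qed.

End SplitEpi.

Theorem theorem5p10 (X Y K : monoidType)
    (f : {mon X -> Y}) (s : {mon Y -> X}) (k : {mon K -> X})
    (fs : f \o s =1 idfun) (kerf : is_kernel k f) :
  (intrinsic_schreier f s k t_direct <-> right_homogeneous f s k) /\
  (intrinsic_schreier f s k t_twisted <-> left_homogeneous f s k) /\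
  (homogeneous f s k <->
     forall t : nat_imag_splitting, intrinsic_schreier f s k t).
Proof.
have schreierP := intrinsic_schreier_orderedP fs kerf.1.
have directP := schreierP _ _ t_direct_ordered.
have twistedP := schreierP _ _ t_twisted_ordered.
split; first exact: directP.
split; first exact: twistedP.
split=> [[hl hr] t|h]; last by split; [apply/twistedP|apply/directP].
by have [[] /schreierP ->] := imag_split_cases t; [exact: hr|exact: hl].
Qed.
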